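(* Let $G=(V,E)$ be a finite undirected graph with $n=|V|$, let $d:E\to\mathbb{R}^+$, let $k,\alpha\ge2$ be integers, and put $\beta=n-(k-1)\alpha$. For every integer $\ell\ne\alpha$ such that $\left\lceil\frac{n}{k}\right\rceil\le\ell\le\beta$, the inequality $$\sum_{i=\ell}^{\beta}\ \sum_{f\in H(i)}x_f\ \le\ \left\lfloor\frac{n-k\alpha}{\ell-\alpha}\right\rfloor$$ is valid for the model $(\mathcal{M}_3)$, where $H(i)$ is the set of members of $\mathcal{F}$ having exactly $i$ nodes.
   Context: $\mathcal{F}$ is the finite family of all induced connected subgraphs of $G$ (identified with their node sets) with number of nodes between $\alpha$ and $\beta$; $|f|$ is the number of nodes of $f\in\mathcal{F}$. For $i\in V$ and $f\in\mathcal{F}$, $a_{if}=1$ if $f$ contains node $i$ and $a_{if}=0$ otherwise; $c_f\ge0$ is the total cost (under $d$) of the edges of $f$. Model $(\mathcal{M}_3)$: minimize $\sum_{f\in\mathcal{F}}c_fx_f$ subject to $\sum_{f\in\mathcal{F}}a_{if}x_f=1$ for all $i\in V$; $\sum_{f\in\mathcal{F}}x_f=k$; $x_f\in\{0,1\}$ for all $f\in\mathcal{F}$. An inequality is valid for the model if every feasible solution of the model satisfies it. *)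

(* Defs.v *)
From HB Require Import structures.
From mathcomp Require Import all_boot all_order all_algebra.
From mathcomp Require Import reals.

Set Implicit Arguments.
Unset Strict Implicit.
Unset Printing Implicit Defensive.

Import Order.TTheory GRing.Theory Num.Theory.

Local Open Scope ring_scope.

(* A graph on [V] is given by its edge set, a set of unordered pairs. *)
Definition simple_graph (V : finType) (E : {set {set V}}) : Prop :=
  forall e, e \in E -> #|e| = 2%N.

Definition induced_adj (V : finType) (E : {set {set V}}) (f : {set V}) :
    rel V :=
  [rel u v | [&& u \in f, v \in f & [set u; v] \in E]].

Definition induced_connected (V : finType) (E : {set {set V}}) (f : {set V}) :
    bool :=
  [forall u in f, forall v in f, connect (induced_adj E f) u v].

(* The upper bound is an integer: n - (k-1) alpha may be negative, in which
   case truncated subtraction would be wrong. *)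
Definition size_ub (V : finType) (k alpha : nat) : int :=
  #|V|%:Z - (k%:Z - 1) * alpha%:Z.

(* Induced connected subgraphs, identified with their node sets. *)
Definition family (V : finType) (E : {set {set V}}) (k alpha : nat) :
    {set {set V}} :=
  [set f : {set V} | [&& induced_connected E f,
                         (alpha <= #|f|)%N
                       & #|f|%:Z <= size_ub V k alpha]].

Definition family_of_size (V : finType) (E : {set {set V}}) (k alpha : nat)
    (i : nat) : {set {set V}} :=
  [set f in family E k alpha | #|f| == i].

Definition incidence (R : realType) (V : finType) (i : V) (f : {set V}) : R :=
  (i \in f)%:R.

Definition subgraph_cost (R : realType) (V : finType) (E : {set {set V}})
    (d : {set V} -> R) (f : {set V}) : R :=
  \sum_(e in E | e \subset f) d e.

Record minimization_model (R : realType) (I : Type) := MinimizationModel {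
  objective : (I -> R) -> R;
  feasible : (I -> R) -> Prop
}.

Definition valid_inequality (R : realType) (I : Type)
    (M : minimization_model R I) (lhs : (I -> R) -> R) (rhs : R) : Prop :=
  forall x : I -> R, feasible M x -> lhs x <= rhs.

(* The variables are indexed by all node sets, but only those indexed by
   members of the family occur in the objective or in a constraint. *)
Definition partition_model (R : realType) (V : finType) (E : {set {set V}})
    (d : {set V} -> R) (k alpha : nat) : minimization_model R {set V} :=
  {| objective := fun x =>
       \sum_(f in family E k alpha) subgraph_cost E d f * x f;
     feasible := fun x =>
       [/\ forall i : V,
             \sum_(f in family E k alpha) incidence R i f * x f = 1,
           \sum_(f in family E k alpha) x f = k%:R
         & forall f, f \in family E k alpha -> x f = 0 \/ x f = 1] |}.

(* Main.v *)
(* Summing the covering constraints over all nodes gives sum_f |f| x_f = n, and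
   subtracting alpha times the cardinality constraint gives
   sum_f (|f| - alpha) x_f = n - k alpha.  Every term is nonnegative, so a
   feasible solution forces n >= k alpha, whence l >= n / k >= alpha and in fact
   l > alpha.  The terms with |f| >= l contribute at most n - k alpha while each
   selected f weighs at least l - alpha; the number of such f being an integer,
   the quotient may be rounded down. *)

Require Import Defs.
From HB Require Import structures.
From mathcomp Require Import all_boot all_order all_algebra.
From mathcomp Require Import reals.

Set Implicit Arguments.
Unset Strict Implicit.
Unset Printing Implicit Defensive.

Import Order.TTheory GRing.Theory Num.Theory.

Local Open Scope ring_scope.

(** Each member of the family lies in exactly one size class, and the upper bound on the size is
    already part of membership. *)
Lemma sum_family_of_size (R : realType) (V : finType) (E : {set {set V}})
    (k alpha : nat) (l : int) (x : {set V} -> R) :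
  \sum_(0 <= i < #|V|.+1 | l <= i%:Z <= size_ub V k alpha)
     \sum_(f in family_of_size E k alpha i) x f
  = \sum_(f in Defs.family E k alpha | l <= #|f|%:Z) x f.
Proof.
rewrite big_mkord.
(* [inord] takes a default value outside its range; [max_card] keeps [#|f|] inside. *)
have cardE (f : {set V}) : nat_of_ord (inord #|f| : 'I_(#|V|.+1)) = #|f|.
  by rewrite inordK // ltnS max_card.
rewrite [RHS](partition_big (fun f : {set V} => inord #|f| : 'I_(#|V|.+1))
  (fun i => l <= i%:Z <= size_ub V k alpha)) /=; last first.
  move=> f /andP[]; rewrite inE => /and3P[_ _ f_le] l_le.
  by rewrite cardE l_le.
apply: eq_bigr => i /andP[l_le _]; apply: eq_bigl => f.
rewrite inE -(inj_eq val_inj) /= cardE.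
case: eqP => [->|_]; last by rewrite !andbF.
by rewrite l_le !andbT.
Qed.

Section FeasibleSolutions.

Variables (R : realType) (V : finType) (E : {set {set V}}).
Variables (d : {set V} -> R) (k alpha : nat) (x : {set V} -> R).
Hypothesis x_feasible : feasible (partition_model E d k alpha) x.

Lemma feasible_sum_card :
  \sum_(f in Defs.family E k alpha) #|f|%:R * x f = #|V|%:R.
Proof.
case: x_feasible => cover _ _.
(* Double counting: in [#|V|] written as a sum of ones, each 1 becomes the covering sum of its
   node. *)
rewrite -sum1_card natr_sum -(eq_bigr _ (fun i _ => cover i)) exchange_big /=.
apply: eq_bigr => f _; rewrite -mulr_suml -sum1_card natr_sum; congr (_ * _).
by rewrite big_mkcond; apply: eq_bigr => i _; rewrite /incidence; case: (i \in f).
Qed.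

Lemma feasible_sum_excess :
  \sum_(f in Defs.family E k alpha) (#|f|%:R - alpha%:R) * x f
  = #|V|%:R - k%:R * alpha%:R.
Proof.
have [_ sum_k _] := x_feasible.
rewrite -feasible_sum_card -sum_k mulrC mulr_sumr -sumrB.
by apply: eq_bigr => f _; rewrite mulrBl.
Qed.

Lemma feasible_ge0 f : f \in Defs.family E k alpha -> 0 <= x f.
Proof. by case: x_feasible => _ _ x01 /x01[] ->. Qed.

Lemma feasible_int f : f \in Defs.family E k alpha -> x f \is a Num.int.
Proof. by case: x_feasible => _ _ x01 /x01[] ->; rewrite ?rpred0 ?rpred1. Qed.

Lemma feasible_excess_ge0 f :
  f \in Defs.family E k alpha -> 0 <= (#|f|%:R - alpha%:R) * x f.
Proof.
move=> Ff; apply: mulr_ge0 (feasible_ge0 Ff).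
by move: Ff; rewrite inE => /and3P[_ f_ge _]; rewrite subr_ge0 ler_nat.
Qed.

Lemma feasible_card_ge : k%:R * alpha%:R <= #|V|%:R :> R.
Proof.
rewrite -subr_ge0 -feasible_sum_excess; apply: sumr_ge0 => f.
exact: feasible_excess_ge0.
Qed.

Lemma feasible_large_le (l : int) :
  \sum_(f in Defs.family E k alpha | l <= #|f|%:Z) (l - alpha%:Z)%:~R * x f
  <= #|V|%:R - k%:R * alpha%:R.
Proof.
(* With the size condition turned into a conditional term, both sums range over the whole family and
   compare termwise. *)
rewrite -feasible_sum_excess big_mkcondr /=; apply: ler_sum => f Ff.
case: ifP => [l_le|_]; last exact: feasible_excess_ge0.
by rewrite ler_wpM2r ?feasible_ge0 // rmorphB /= lerB //
           -[leRHS]/(#|f|%:Z%:~R) ler_int.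
Qed.

End FeasibleSolutions.

Theorem theorem12 (R : realType) (V : finType) (E : {set {set V}})
    (simpleE : simple_graph E)
    (d : {set V} -> R) (d_ge0 : forall e, e \in E -> 0 <= d e)
    (k alpha : nat) (k_ge2 : (2 <= k)%N) (alpha_ge2 : (2 <= alpha)%N)
    (l : int) (l_neq : l <> alpha%:Z)
    (l_ge : Num.ceil (#|V|%:R / k%:R : R) <= l)
    (l_le : l <= size_ub V k alpha) :
  valid_inequality (partition_model E d k alpha)
    (fun x => \sum_(0 <= i < #|V|.+1 | l <= i%:Z <= size_ub V k alpha)
                \sum_(f in family_of_size E k alpha i) x f)
    (Num.floor ((#|V|%:R - k%:R * alpha%:R) / (l - alpha%:Z)%:~R : R))%:~R.
Proof.
move=> x x_feasible; rewrite sum_family_of_size.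
have k_gt0 : 0 < k%:R :> R by rewrite ltr0n (leq_trans _ k_ge2).
have alpha_le : alpha%:Z <= l.
  rewrite -(ler_int R); move: l_ge; rewrite ceil_le_int; apply: le_trans.
  by rewrite ler_pdivlMr // mulrC (feasible_card_ge x_feasible).
have l_gt : 0 < (l - alpha%:Z)%:~R :> R.
  by rewrite ltr0z subr_gt0 lt_neqAle alpha_le andbT eq_sym; apply/eqP.
(* Naming the integer value [m] lets [floor_ge_int] trade the floor for its real argument. *)
have /intrP[m sumE] :
    \sum_(f in Defs.family E k alpha | l <= #|f|%:Z) x f \is a Num.int.
  by apply: rpred_sum => f /andP[Ff _]; exact: (feasible_int x_feasible).
rewrite sumE ler_int floor_ge_int -sumE ler_pdivlMr // mulrC mulr_sumr.
exact: (feasible_large_le x_feasible).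
Qed.
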